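(* Let $X$ be a Banach space and let $F:[0,1]\to 2^{X}\setminus\{\varnothing\}$ be a compact-valued bounded multifunction. Then $I(\operatorname{conv}F)=I(F)$.
   Context: For subsets $A,B$ of a Banach space $X$ and $\lambda\in\mathbb{R}$: $A+B=\{a+b: a\in A, b\in B\}$, $\lambda A=\{\lambda a: a\in A\}$. A tagged partition $(\Gamma,T)$ of $[0,1]$ consists of a partition $\Gamma=\{\Delta_i\}_{i=1}^n$ of $[0,1]$ into (non-overlapping closed) segments $\Delta_i=[a_i,b_i]$ and tags $T=\{\xi_i\}_{i=1}^n$, $\xi_i\in\Delta_i$. Write $|\Delta_i|=b_i-a_i$ and $d(\Gamma)=\max_i|\Delta_i|$. A multifunction is a map $F:[0,1]\to 2^X\setminus\{\varnothing\}$. It is bounded if $M(F)=\sup\{\|a\|: a\in F(t), t\in[0,1]\}<\infty$, and compact-valued if $F(t)$ is compact for every $t$. Its Riemann sums are $S(F,\Gamma,T)=\sum_{i=1}^n|\Delta_i|F(\xi_i)$ (Minkowski sum). The multifunction $\operatorname{conv}F$ is defined by $(\operatorname{conv}F)(t)=\operatorname{conv}(F(t))$ (convex hull). The Hausdorff distance between non-empty sets is $d_H(A,B)=\max\{\sup_{a\in A}d(a,B),\sup_{b\in B}d(b,A)\}$. For bounded $F$, $I(F)$ is the collection of all non-empty closed subsets $A\subset X$ for which there is a sequence of tagged partitions $(\Gamma_k,T_k)$ with $d(\Gamma_k)\to0$ and $d_H(S(F,\Gamma_k,T_k),A)\to0$ as $k\to\infty$. *)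

(* Defs.v *)
From HB Require Import structures.
From mathcomp Require Import all_boot all_order all_algebra.
From mathcomp Require Import all_classical all_reals all_analysis.

Set Implicit Arguments.
Unset Strict Implicit.
Unset Printing Implicit Defensive.

Import Order.TTheory GRing.Theory Num.Theory.
Import numFieldNormedType.Exports.

Local Open Scope classical_set_scope.
Local Open Scope ring_scope.

Section SetOperations.
Context {R : realType} {X : normedModType R}.

Definition set_add (A B : set X) : set X := [set a + b | a in A & b in B].

Definition set_scale (l : R) (A : set X) : set X := [set l *: a | a in A].

Definition conv_hull (A : set X) : set X := smallest (@convex_set R X) A.

End SetOperations.

(* The values are extended reals: the distance is +oo between a bounded set
   and an unbounded one, for instance. *)
Definition hausdorff_dist {R : realType} {X : pseudoMetricType R}
    (A B : set X) : \bar R :=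
  Order.max (ereal_sup [set edist_inf B a | a in A])
            (ereal_sup [set edist_inf A b | b in B]).

(* The library defines edist from balls; in a normed space it is the distance
   associated with the norm, so that edist_inf B a is d(a, B). *)
Lemma edist_norm (R : realType) (X : normedModType R) (x y : X) :
  edist (x, y) = `|x - y|%:E.
Proof.
apply/le_anti/andP; split; last first.
  apply: le_ereal_inf_tmp => _ [r [_ /=]] + <-.
  by rewrite -ball_normE /= lee_fin => /ltW.
apply/lee_addgt0Pr => e e0; rewrite -EFinD.
apply: edist_fin; first by rewrite ltr_wpDl.
by rewrite -ball_normE /= ltrDl.
Qed.

(* The segments are listed from left to right: the partition of [0, 1] by the
   points 0 < x_0 < ... < x_(n-1) = 1 is given by the sequence
   [:: x_0; ...; x_(n-1)], and its i-th segment is [x_(i-1), x_i],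
   with x_(-1) = 0. *)
Record tagged_partition (R : realType) := TaggedPartition {
  cuts : seq R ;
  seg_tag : 'I_(size cuts) -> R ;
  cutsP : itv_partition 0 1 cuts ;
  seg_tagP : forall i, seg_tag i \in `[(0 :: cuts)`_i, cuts`_i] }.

Section RiemannSums.
Context {R : realType}.
Implicit Type P : tagged_partition R.

Definition seg_length P (i : 'I_(size (cuts P))) : R :=
  (cuts P)`_i - (0 :: cuts P)`_i.

Definition mesh P : R := \big[Num.max/0]_(i < size (cuts P)) seg_length i.

Context {X : normedModType R}.
Implicit Type F : R -> set X.

Definition riemann_sum F P : set X :=
  \big[set_add/[set 0]]_(i < size (cuts P))
    set_scale (seg_length i) (F (seg_tag i)).

Definition multifun_sup_norm F : \bar R :=
  ereal_sup [set `|a|%:E | a in \bigcup_(t in `[0, 1]) F t].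

Definition bounded_multifun F := (multifun_sup_norm F < +oo)%E.

Definition conv_multifun F : R -> set X := fun t => conv_hull (F t).

Definition riemann_limit_sets F : set (set X) :=
  [set A | [/\ A !=set0, closed A &
    exists P : nat -> tagged_partition R,
      mesh (P k) @[k --> \oo] --> (0 : R) /\
      hausdorff_dist (riemann_sum F (P k)) A @[k --> \oo] --> 0%E]].

End RiemannSums.

(* Main.v *)
Require Import Defs.
From HB Require Import structures.
From mathcomp Require Import all_boot all_order all_algebra finmap.
From mathcomp Require Import all_classical all_reals all_analysis.
From mathcomp Require Import ring lra.
Import Order.TTheory GRing.Theory Num.Theory.
Import numFieldNormedType.Exports.

Local Open Scope classical_set_scope.
Local Open Scope ring_scope.

(* The same tagged partitions witness both inclusions: along any sequence P_k
   with mesh tending to 0, the sums of F converge to A iff those of conv F do.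
   The values of F being compact, the Riemann sums are totally bounded, so A and
   its convex hull are; hence the sums of conv F eventually lie within e of a
   totally bounded set K. On K - K the norm is controlled, up to e, by finitely
   many functionals f_1, ..., f_n norming a finite net. A point
   x = sum |D_i| g_i with g_i in conv F(xi_i) is then rounded to
   y = sum |D_i| a_i with a_i in F(xi_i), choosing the a_i one at a time so that
   sum_j f_j(x - y)^2 <= n (2M)^2 sum |D_i|^2 <= n (2M)^2 mesh(P_k) -> 0.
   Thus x - y, which is close to K - K, is small in norm. *)

Set Implicit Arguments.
Unset Strict Implicit.

(** * The Hahn-Banach theorem via minimal sublinear functionals *)

Section HahnBanach.
Context {R : realType} {X : lmodType R}.
Implicit Types (p q : X -> R) (x y z : X).

(** Homogeneity is stated as an inequality, which is easier to check for infima; applying it to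
    [a^-1] as well gives equality in [sublinearZ]. *)
Definition sublinear p :=
  (forall x y, p (x + y) <= p x + p y) /\
  (forall a x, 0 <= a -> p (a *: x) <= a * p x).

Lemma sublinearZ p a x : sublinear p -> 0 <= a -> p (a *: x) = a * p x.
Proof.
move=> [pD pZ]; rewrite le_eqVlt => /predU1P[<-|a0]; apply/le_anti.
  have := pZ 0 x (lexx _); rewrite mul0r scale0r => ->/=.
  by have := pD 0 0; rewrite addr0; lra.
rewrite (pZ a x (ltW a0))/= -ler_pdivlMl//.
have a'0 : 0 <= a^-1 by rewrite invr_ge0 ltW.
by have := pZ _ (a *: x) a'0; rewrite scalerA mulVf ?gt_eqF// scale1r.
Qed.

Lemma sublinear0 p : sublinear p -> p 0 = 0.
Proof. by move=> sp; rewrite -(scale0r 0) sublinearZ// mul0r. Qed.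

Lemma sublinear_geN p x : sublinear p -> - p (- x) <= p x.
Proof.
by move=> sp; rewrite -subr_ge0 opprK -(sublinear0 sp) -(subrr x); case: sp.
Qed.

(* The largest sublinear functional below p whose value at - y is at most - p y:
   a minimal sublinear functional coincides with it, hence is odd. *)
Definition tilt p y x : R := inf [set p (x + t *: y) - t * p y | t in [set t | 0 <= t]].

Lemma tilt_le p y x t : sublinear p -> 0 <= t ->
  tilt p y x <= p (x + t *: y) - t * p y.
Proof.
move=> sp t0; apply: ge_inf; last by exists t.
(* This lower bound, from [s * p y = p (s *: y) <= p (x + s *: y) + p (- x)], makes [inf] a true
   infimum rather than a default value. *)
exists (- p (- x)) => _ [s /= s0 <-].
have := sp.1 (x + s *: y) (- x); rewrite addrC addKr sublinearZ//; lra.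
Qed.

Lemma le_tilt p y x c :
  (forall t, 0 <= t -> c <= p (x + t *: y) - t * p y) -> c <= tilt p y x.
Proof.
move=> H; apply: lb_le_inf; first by exists (p (x + 0 *: y) - 0 * p y), 0 => /=.
by move=> _ [t /= t0 <-]; exact: H.
Qed.

(** Parameters [s] for [x] and [t] for [z] combine into [s + t] for [x + z]; for [a *: x] the
    parameter [t] becomes [a * t]. *)
Lemma sublinear_tilt p y : sublinear p -> sublinear (tilt p y).
Proof.
move=> sp; split=> [x z|a x].
  rewrite -lerBlDl; apply: le_tilt => t t0.
  rewrite lerBlDl -lerBlDr; apply: le_tilt => s s0.
  rewrite lerBlDr; apply: le_trans (tilt_le _ _ sp (addr_ge0 s0 t0)) _.
  have := sp.1 (x + s *: y) (z + t *: y).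
  by rewrite addrACA -scalerDl; lra.
rewrite le_eqVlt => /predU1P[<-|a0].
  rewrite mul0r scale0r (le_trans (tilt_le y 0 sp (lexx 0)))//.
  by rewrite scale0r mul0r subr0 addr0 sublinear0.
rewrite -ler_pdivrMl//; apply: le_tilt => t t0; rewrite ler_pdivrMl//.
apply: le_trans (tilt_le _ _ sp (mulr_ge0 (ltW a0) t0)) _.
rewrite -scalerA -scalerDr (sublinearZ _ sp (ltW a0)); lra.
Qed.

Lemma tilt_le_id p y x : sublinear p -> tilt p y x <= p x.
Proof.
by move=> sp; have := tilt_le y x sp (lexx 0); rewrite scale0r mul0r subr0 addr0.
Qed.

Lemma tiltN p y : sublinear p -> tilt p y (- y) <= - p y.
Proof.
move=> sp; have := tilt_le y (- y) sp ler01.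
by rewrite scale1r addNr sublinear0// mul1r sub0r.
Qed.

Lemma minimal_sublinear p : sublinear p ->
  exists2 q, sublinear q /\ (forall x, q x <= p x) &
    forall r, sublinear r -> (forall x, r x <= q x) -> r = q.
Proof.
move=> sp; pose T := {q | sublinear q /\ forall x, q x <= p x}.
(* The order is reversed, so that a maximal element in Zorn's lemma is a minimal functional. *)
pose below (q r : T) := `[< forall x, sval r x <= sval q x >].
have [||||[q [sq qp]] qmin] := @Zorn T below.
- by move=> q; apply/asboolP.
- move=> q r s /asboolP qr /asboolP rs; apply/asboolP => x.
  exact: le_trans (rs x) (qr x).
- move=> [q Hq] [r Hr] /asboolP /= qr /asboolP/= rq; apply: eq_exist.
  by apply/funext => x; apply/le_anti; rewrite qr rq.
- move=> A Atot; have [[q0 Aq0]|A0] := pselect (A !=set0); last first.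
    by exists (exist _ p (conj sp (fun x => lexx _))) => s As; case: A0; exists s.
  (* A nonempty chain is bounded by its pointwise infimum, finite since every member is at least
     [- p (- x)] at [x]. *)
  pose m x := inf [set sval q x | q in A].
  have m_le (q : T) x : A q -> m x <= sval q x.
    move=> Aq; apply: ge_inf; last by exists q.
    exists (- p (- x)) => _ [[r [sr rp]] Ar <-] /=.
    by apply: le_trans (sublinear_geN _ sr); rewrite lerN2.
  have le_m c x : (forall q : T, A q -> c <= sval q x) -> c <= m x.
    move=> H; apply: lb_le_inf; first by exists (sval q0 x), q0.
    by move=> _ [q Aq <-]; exact: H.
  have sm : sublinear m.
    split=> [x y|a x].
      rewrite -lerBlDl; apply: (le_m) => q Aq.
      rewrite lerBlDl -lerBlDr; apply: (le_m) => r Ar; rewrite lerBlDr.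
      (* Subadditivity of the smaller of [q] and [r] bounds [m (x + y)] by [r x + q y]. *)
      have [/asboolP H|/asboolP H] := Atot _ _ Aq Ar.
        apply: le_trans (m_le _ _ Ar) _; apply: le_trans ((svalP r).1.1 _ _) _.
        by rewrite lerD2l.
      apply: le_trans (m_le _ _ Aq) _; apply: le_trans ((svalP q).1.1 _ _) _.
      by rewrite lerD2r.
    rewrite le_eqVlt => /predU1P[<-|a0].
      rewrite mul0r scale0r (le_trans (m_le _ _ Aq0))//.
      by rewrite sublinear0//; exact: (svalP q0).1.
    rewrite -ler_pdivrMl//; apply: (le_m) => q Aq; rewrite ler_pdivrMl//.
    apply: le_trans (m_le _ _ Aq) _; apply: (svalP q).1.2; exact: ltW.
  have mp x : m x <= p x by exact: le_trans (m_le _ _ Aq0) ((svalP q0).2 x).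
  exists (exist _ m (conj sm mp)) => q Aq; apply/asboolP => x /=; exact: m_le.
exists q => // r sr rq.
have rp x : r x <= p x by exact: le_trans (rq x) (qp x).
by have /(_ _)/(congr1 sval) := qmin (exist _ r (conj sr rp)); apply; apply/asboolP.
Qed.

(** A minimal functional is odd; oddness turns subadditivity into additivity and extends homogeneity
    to negative scalars. *)
Lemma hahn_banach p : sublinear p ->
  exists f : {scalar X}, forall x, f x <= p x.
Proof.
move=> /minimal_sublinear[q [sq qp] qmin].
have qN x : q (- x) = - q x.
  have tq : tilt q x = q.
    by apply: qmin (sublinear_tilt x sq) _ => y; exact: tilt_le_id.
  have := tiltN x sq; rewrite tq => qN.
  by apply/le_anti/andP; rewrite qN lerNl; split=> //; exact: sublinear_geN.
have qlin : linear_for *%R q.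
  move=> a x y.
  have qD u v : q (u + v) = q u + q v.
    apply/le_anti; rewrite sq.1/= -lerBrDr -qN.
    by apply: le_trans (sq.1 _ _); rewrite addrK.
  rewrite qD; congr (_ + _).
  have [a0|/ltW a0] := leP 0 a; first by rewrite sublinearZ.
  by rewrite -{1}[a]opprK scaleNr qN sublinearZ ?oppr_ge0// mulNr opprK.
pose L := GRing.isLinear.Build R X R *%R q qlin.
by exists (HB.pack_for {scalar X} q L).
Qed.

End HahnBanach.

(** A linear functional below the tilt of the norm at [x0] is below the norm and at most [- |x0|] at
    [- x0]. *)
Lemma norming_functional (R : realType) (X : normedModType R) (x0 : X) :
  exists f : {scalar X}, (forall x, `|f x| <= `|x|) /\ f x0 = `|x0|.
Proof.
pose p (x : X) : R := `|x|.
have sp : sublinear p.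
  by split=> [x y|a x a0]; [exact: ler_normD|rewrite /p normrZ ger0_norm].
have [f fle] := hahn_banach (sublinear_tilt x0 sp).
have fp x : f x <= `|x| by apply: le_trans (fle x) _; exact: tilt_le_id.
exists f; split=> [x|].
  by rewrite ler_norml fp andbT lerNl -linearN (le_trans (fp _))// normrN.
apply/le_anti; rewrite fp/= -lerN2 -linearN.
by apply: le_trans (fle _) _; exact: tiltN.
Qed.

(** * Convex hulls and totally bounded sets *)

Section ConvexSets.
Context {R : realType} {X : normedModType R}.
Implicit Types (A B : set X) (x y : X) (e l : R).

Lemma convex_setP A : @convex_set R X A <->
  forall x y l, 0 <= l <= 1 -> A x -> A y -> A (l *: x + (1 - l) *: y).
Proof.
split=> [cA x y l /andP[l0 l1] Ax Ay|cA x y l /set_mem Ax /set_mem Ay].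
  by have := cA x y (Itv01 l0 l1) (mem_set Ax) (mem_set Ay) => /set_mem.
by apply/mem_set; apply: cA => //; rewrite ge0 le1.
Qed.

Lemma convex_set_add A B :
  @convex_set R X A -> @convex_set R X B -> @convex_set R X (set_add A B).
Proof.
move=> /convex_setP cA /convex_setP cB; apply/convex_setP.
move=> _ _ l l01 [a Aa [b Bb <-]] [a' Aa' [b' Bb' <-]].
exists (l *: a + (1 - l) *: a'); first exact: cA.
exists (l *: b + (1 - l) *: b'); first exact: cB.
by rewrite !scalerDr addrACA.
Qed.

Lemma convex_set1 x : @convex_set R X [set x].
Proof.
apply/convex_setP => _ _ l _ -> ->.
by rewrite -scalerDl subrKC scale1r.
Qed.

Lemma convex_conv_hull A : @convex_set R X (conv_hull A).
Proof.
apply/convex_setP => x y l l01 cx cy B [cB AB].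
have /convex_setP := cB; apply => //; [exact: cx|exact: cy].
Qed.

Lemma sub_conv_hull A : A `<=` conv_hull A.
Proof. exact: sub_gen_smallest. Qed.

Lemma conv_hull_sub A B : @convex_set R X B -> A `<=` B -> conv_hull A `<=` B.
Proof. exact: smallest_sub. Qed.

(** Otherwise [A], and with it its hull, would lie in the convex open half-space [f y < f x], which
    misses [x]. *)
Lemma conv_hull_scalar (f : {scalar X}) A x :
  conv_hull A x -> exists2 a, A a & f x <= f a.
Proof.
move=> Ax; apply: contrapT => H.
have : conv_hull A `<=` [set y | f y < f x].
  apply: conv_hull_sub => [|a Aa /=].
    apply/convex_setP => y z l /andP[l0 l1] /= fy fz.
    rewrite linearD !linearZ /=.
    (* For [l > 0] the strict inequality comes from the first term; at [l = 0] that term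
       vanishes. *)
    have [->|l0'] := eqVneq l 0; first by rewrite mul0r add0r subr0 mul1r.
    have {}l0 : 0 < l by rewrite lt_neqAle eq_sym l0'.
    have := ltr_pM2l l0 (f y) (f x); rewrite fy => H1.
    have : (1 - l) * f z <= (1 - l) * f x.
      by rewrite ler_wpM2l ?subr_ge0// ltW.
    lra.
  by rewrite ltNge; apply/negP => le; apply: H; exists a.
by move=> /(_ x Ax) /=; rewrite ltxx.
Qed.

(* Slightly stronger than sup_(a in A) d(a, B) <= e, where the infimum d(a, B)
   need not be attained. *)
Definition excess_le e A B := forall a, A a -> exists2 b, B b & `|a - b| <= e.

Lemma excess_le_refl e A B : 0 <= e -> A `<=` B -> excess_le e A B.
Proof. by move=> e0 AB a Aa; exists a; [exact: AB|rewrite subrr normr0]. Qed.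

Lemma excess_le_trans A B C e e' :
  excess_le e A B -> excess_le e' B C -> excess_le (e + e') A C.
Proof.
move=> AB BC a /AB[b /BC[c Cc bc] ab]; exists c => //.
by rewrite (le_trans (ler_distD b _ _))// lerD.
Qed.

(** The points within [e] of some point of a convex set form a convex set. *)
Lemma excess_le_conv_hull e A B : @convex_set R X B ->
  excess_le e A B -> excess_le e (conv_hull A) B.
Proof.
move=> /convex_setP cB AB.
suff /conv_hull_sub : @convex_set R X [set x | exists2 b, B b & `|x - b| <= e].
  by apply => a /AB.
apply/convex_setP => x y l l01 [b Bb xb] [c Bc yc].
exists (l *: b + (1 - l) *: c); first exact: cB.
rewrite opprD addrACA -!scalerBr (le_trans (ler_normD _ _))// !normrZ.
have /andP[l0 l1] := l01; rewrite !ger0_norm ?subr_ge0//.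
have := ler_wpM2l l0 xb; have : 0 <= 1 - l by rewrite subr_ge0.
by move=> /ler_wpM2l /(_ _ _ yc); lra.
Qed.

(** The net need not lie in [A], so a net of a nearby or larger set serves. *)
Definition totally_bounded A :=
  forall e, 0 < e -> exists s : seq X, excess_le e A [set` s].

Lemma totally_bounded_excess A :
  (forall e, 0 < e -> exists2 B, totally_bounded B & excess_le e A B) ->
  totally_bounded A.
Proof.
move=> H e e0; have e20 : 0 < e / 2 by rewrite divr_gt0.
have [B tB AB] := H _ e20; have [s Bs] := tB _ e20.
by exists s; rewrite [e]splitr; exact: excess_le_trans AB Bs.
Qed.

Lemma totally_bounded1 x : totally_bounded [set x].
Proof.
move=> e e0; exists [:: x]; apply: excess_le_refl; first exact: ltW.
by move=> _ -> /=; rewrite mem_head.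
Qed.

Lemma totally_bounded_add A B :
  totally_bounded A -> totally_bounded B -> totally_bounded (set_add A B).
Proof.
move=> tA tB e e0; have e20 : 0 < e / 2 by rewrite divr_gt0.
have [s As] := tA _ e20; have [t Bt] := tB _ e20.
exists [seq x + y | x <- s, y <- t] => _ [a Aa [b Bb <-]].
have [x /= xs ax] := As _ Aa; have [y /= yt by_] := Bt _ Bb.
exists (x + y); first by apply/allpairsP; exists (x, y).
by rewrite opprD addrACA (le_trans (ler_normD _ _))// [e]splitr lerD.
Qed.

Lemma totally_bounded_scale l A :
  totally_bounded A -> totally_bounded (set_scale l A).
Proof.
move=> tA e e0; have l0 : 0 < `|l| + 1 by rewrite ltr_wpDl.
have [s As] := tA _ (divr_gt0 e0 l0).
exists [seq l *: x | x <- s] => _ [a Aa <-].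
have [x /= xs ax] := As _ Aa; exists (l *: x); first exact: map_f.
rewrite -scalerBr normrZ (le_trans (ler_wpM2l _ ax))//.
by rewrite mulrCA ger_pMr// ler_pdivrMr// mul1r lerDl.
Qed.

Lemma compact_totally_bounded A : compact A -> totally_bounded A.
Proof.
rewrite compact_cover => cA e e0.
have [|x Ax|D' _ AD] := cA X A (fun x => ball x e).
- by move=> x _; exact: ball_open.
- by exists x => //; exact: ballxx.
exists (enum_fset D') => a /AD[x xD]; rewrite -ball_normE /= => xa.
by exists x => //; rewrite distrC ltW.
Qed.

Lemma convex_segment x : @convex_set R X [set l *: x | l in `[0, 1]].
Proof.
apply/convex_setP => _ _ l /andP[l0 l1] [t + <-] [u + <-].
rewrite /= !in_itv/= => /andP[t0 t1] /andP[u0 u1].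
exists (l * t + (1 - l) * u); last by rewrite !scalerA -scalerDl.
have l10 : 0 <= 1 - l by rewrite subr_ge0.
rewrite /= in_itv/= addr_ge0 ?mulr_ge0//=.
have := ler_wpM2l l0 t1; have := ler_wpM2l l10 u1; lra.
Qed.

Lemma totally_bounded_segment x : totally_bounded [set l *: x | l in `[0, 1]].
Proof.
apply: compact_totally_bounded; apply: continuous_compact.
  by apply: continuous_subspaceT => l; exact: scalel_continuous.
exact: segment_compact.
Qed.

(* The hull of a finite net is replaced by the zonotope spanned by the net, a
   Minkowski sum of segments that is convex and contains the net. *)
Lemma totally_bounded_conv_hull A : totally_bounded A -> totally_bounded (conv_hull A).
Proof.
move=> tA; apply: totally_bounded_excess => e /tA[s As].
pose Z := \big[set_add/[set 0]]_(x <- s) [set l *: x | l in `[0, 1]%classic] : set X.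
have cZ : @convex_set R X Z.
  rewrite /Z; elim/big_ind : _ => [|B C|x _].
  - exact: convex_set1.
  - exact: convex_set_add.
  - exact: convex_segment.
exists Z.
  rewrite /Z; elim/big_ind : _ => [|B C|x _].
  - exact: totally_bounded1.
  - exact: totally_bounded_add.
  - exact: totally_bounded_segment.
apply: excess_le_conv_hull => // a /As[x /= xs ax]; exists x => //.
(* A net point is reached with coefficient 1 on its own segment and 0 on the others. *)
have Z0 t :
    (\big[set_add/[set 0]]_(x <- t) [set l *: x | l in `[0, 1]%classic] : set X) 0.
  elim: t => [|y t IH]; first by rewrite big_nil.
  rewrite big_cons; exists 0; last by exists 0; rewrite ?addr0.
  by exists 0; rewrite ?scale0r//= in_itv/= lexx ler01.
rewrite /Z {As ax cZ Z} /=; elim: s xs => // y s IH.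
rewrite inE big_cons => /predU1P[->|xs].
  exists y; last by exists 0; rewrite ?addr0.
  by exists 1; rewrite ?scale1r//= in_itv/= lexx ler01.
exists 0; last by exists x; rewrite ?add0r//; exact: IH.
by exists 0; rewrite ?scale0r//= in_itv/= lexx ler01.
Qed.

End ConvexSets.

(** * Minkowski sums of convex hulls and the rounding of their points *)

Section MinkowskiSums.
Context {R : realType} {X : normedModType R}.
Implicit Types A B : set X.

(** Translates of convex sets are convex, so each summand can be reduced from the hull to the set
    while the other is fixed. *)
Lemma set_add_conv_hull A B :
  set_add (conv_hull A) (conv_hull B) `<=` conv_hull (set_add A B).
Proof.
have tr (T : set X) z : @convex_set R X T -> @convex_set R X [set y | T (z + y)].
  move=> /convex_setP cT; apply/convex_setP => x y l l01 /= Tx Ty.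
  have := cT _ _ _ l01 Tx Ty; rewrite !scalerDr addrACA -scalerDl.
  by rewrite subrKC scale1r.
have cH := @convex_conv_hull R X (set_add A B).
move=> _ [a cAa [b cBb <-]]; rewrite addrC.
apply: (conv_hull_sub (tr _ b cH) _ cAa) => {cAa}a Aa /=; rewrite addrC.
apply: (conv_hull_sub (tr _ a cH) _ cBb) => {cBb}b Bb /=.
by apply: sub_conv_hull; exists a => //; exists b.
Qed.

Lemma set_scale_conv_hull (l : R) A :
  set_scale l (conv_hull A) `<=` conv_hull (set_scale l A).
Proof.
move=> _ [x Ax <-].
suff : @convex_set R X [set y | conv_hull (set_scale l A) (l *: y)].
  move=> cT; apply: (conv_hull_sub cT _ Ax) => a Aa /=.
  by apply: sub_conv_hull; exists a.
have /convex_setP cT := @convex_conv_hull R X (set_scale l A).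
apply/convex_setP => y z t t01 /= Ty Tz.
have := cT _ _ _ t01 Ty Tz.
by rewrite scalerDr !scalerA mulrC [(1 - t) * _]mulrC.
Qed.

Variables (I : Type) (r : seq I) (l : I -> R).
Implicit Types C D : I -> set X.

Local Notation msum C := (\big[set_add/[set 0]]_(i <- r) set_scale (l i) (C i)).

Lemma minkowski_sum_nonempty C : (forall i, C i !=set0) -> msum C !=set0.
Proof.
move=> C0; elim/big_ind : _ => [|A B [a Aa] [b Bb]|i _]; first by exists 0.
  by exists (a + b), a => //; exists b.
by have [c Cc] := C0 i; exists (l i *: c), c.
Qed.

Lemma minkowski_sum_sub C D : (forall i, C i `<=` D i) -> msum C `<=` msum D.
Proof.
move=> CD; elim/big_ind2 : _ => [//|A A' B B' AA' BB'|i _].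
  by move=> _ [a Aa [b Bb <-]]; exists a; [exact: AA'|exists b => //; exact: BB'].
by move=> _ [c /CD Dc <-]; exists c.
Qed.

(** Transfers an excess bound from the sums of [F] to those of [conv_multifun F] when the target is
    convex. *)
Lemma minkowski_sum_conv_hull C :
  msum (fun i => conv_hull (C i)) `<=` conv_hull (msum C).
Proof.
elim/big_ind2 : _ => [|A A' B B' AA' BB'|i _]; first exact: sub_conv_hull.
  apply: subset_trans (@set_add_conv_hull _ _).
  by move=> _ [a Aa [b Bb <-]]; exists a; [exact: AA'|exists b => //; exact: BB'].
exact: set_scale_conv_hull.
Qed.

Lemma totally_bounded_minkowski_sum C :
  (forall i, totally_bounded (C i)) -> totally_bounded (msum C).
Proof.
move=> tC; elim/big_ind : _ => [|A B|i _].
- exact: totally_bounded1.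
- exact: totally_bounded_add.
- exact: totally_bounded_scale.
Qed.

End MinkowskiSums.

Lemma ball0_conv_hull (R : realType) (X : normedModType R) (A : set X) M x :
  (forall a, A a -> `|a| <= M) -> conv_hull A x -> `|x| <= M.
Proof.
move=> AM.
have : excess_le M A [set 0] by move=> a /AM aM; exists 0; rewrite ?subr0.
by move=> /(excess_le_conv_hull (@convex_set1 R X 0)) H /H[_ ->]; rewrite subr0.
Qed.

(* Derandomisation: a point of A_i drawn with mean g_i makes the mixed term
   2 l_i sum_j f_j(x - y) f_j(g_i - a_i) vanish on average, so some a_i makes it
   nonpositive and the sum of squares grows only by the terms in l_i ^ 2. *)
Lemma minkowski_sum_selection (R : realType) (X : normedModType R)
    (I : Type) (r : seq I) (l : I -> R) (A : I -> set X)
    (n : nat) (f : 'I_n -> {scalar X}) (M : R) (x : X) :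
  (forall i a, A i a -> `|a| <= M) ->
  (forall j a, `|f j a| <= `|a|) ->
  (\big[set_add/[set 0]]_(i <- r) set_scale (l i) (conv_hull (A i))) x ->
  exists2 y, (\big[set_add/[set 0]]_(i <- r) set_scale (l i) (A i)) y &
    \sum_(j < n) f j (x - y) ^+ 2
      <= n%:R * (2 * M) ^+ 2 * \sum_(i <- r) l i ^+ 2.
Proof.
move=> AM f1; elim: r x => [|i r IH] x.
  rewrite !big_nil => ->; exists 0 => //.
  by rewrite subrr mulr0 big1// => j _; rewrite linear0 expr0n.
rewrite !big_cons => -[_ [g Ag <-]] [x' /IH[y' Ay' xy'] <-] {IH}.
(* The mixed term of the expanded squares is [2 * (L g - L a)]. As [L] is a single linear
   functional, [conv_hull_scalar] gives [a] with [L g <= L a]. *)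
pose L a := \sum_j (l i * f j (x' - y')) * f j a.
have Llin : linear_for *%R L.
  move=> t u v; rewrite /L mulr_sumr -big_split; apply: eq_bigr => j _ /=.
  by rewrite [f j (t *: u + v)]linearP /=; ring.
pose L' : {scalar X} := HB.pack_for {scalar X} L (GRing.isLinear.Build R X R *%R L Llin).
have [a Aa Lga] := @conv_hull_scalar _ _ L' _ _ Ag.
exists (l i *: a + y').
  by exists (l i *: a); [exists a|exists y'].
have gM : `|g| <= M by apply: ball0_conv_hull Ag => b; exact: AM.
have -> : l i *: g + x' - (l i *: a + y') = (x' - y') + l i *: (g - a).
  by rewrite scalerBr opprD addrACA addrC.
have -> : \sum_(j < n) f j (x' - y' + l i *: (g - a)) ^+ 2 =
    \sum_(j < n) f j (x' - y') ^+ 2 + 2 * (L g - L a)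
    + l i ^+ 2 * \sum_(j < n) f j (g - a) ^+ 2.
  rewrite /L -sumrB !mulr_sumr -!big_split; apply: eq_bigr => j _ /=.
  by rewrite [x' - y' + _]addrC linearP /= [f j (g - a)]linearB /=; ring.
have H : \sum_(j < n) f j (g - a) ^+ 2 <= n%:R * (2 * M) ^+ 2.
  apply: (@le_trans _ _ (\sum_(j < n) (2 * M) ^+ 2)).
    apply: ler_sum => j _; rewrite -real_normK ?num_real//.
    rewrite ler_sqr ?nnegrE//; last by have := normr_ge0 g; lra.
    rewrite (le_trans (f1 _ _))// (le_trans (ler_normB _ _))//.
    by have := AM _ _ Aa; lra.
  by rewrite sumr_const card_ord [n%:R * _]mulr_natl.
have := ler_wpM2l (sqr_ge0 (l i)) H; have {}Lga : L g <= L a by [].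
rewrite mulrDr; lra.
Qed.

(** * Hausdorff convergence expressed by excesses *)

Section Hausdorff.
Context {R : realType} {X : normedModType R}.
Implicit Types (A B : set X) (e : R).

Lemma hausdorff_dist_le e A B : excess_le e A B -> excess_le e B A ->
  (hausdorff_dist A B <= e%:E)%E.
Proof.
have sup_le C D : excess_le e C D ->
    (ereal_sup [set edist_inf D c | c in C] <= e%:E)%E.
  move=> CD; apply: ge_ereal_sup => _ [c /CD[d Dd cd] <-].
  apply: (@le_trans _ _ (edist (c, d))); last by rewrite edist_norm lee_fin.
  by apply: ereal_inf_lbound; exists d.
by move=> AB BA; rewrite /hausdorff_dist ge_max !sup_le.
Qed.

Lemma hausdorff_dist_lt e A B : (hausdorff_dist A B < e%:E)%E ->
  excess_le e A B /\ excess_le e B A.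
Proof.
have sup_lt C D : (ereal_sup [set edist_inf D c | c in C] < e%:E)%E ->
    excess_le e C D.
  move=> CDe c Cc.
  have : (edist_inf D c < e%:E)%E.
    by apply: le_lt_trans CDe; apply: ereal_sup_ubound; exists c.
  by move=> /ereal_inf_lt[_ [d Dd <-]]; rewrite edist_norm lte_fin => /ltW; exists d.
by rewrite /hausdorff_dist gt_max => /andP[/sup_lt AB /sup_lt].
Qed.

(** A point of [A] is required because a supremum over the empty set is [-oo]. *)
Lemma hausdorff_dist_ge0 A B : A !=set0 -> (0 <= hausdorff_dist A B)%E.
Proof.
move=> [a Aa]; rewrite /hausdorff_dist le_max; apply/orP; left.
apply: le_trans (edist_inf_ge0 B a) _.
by apply: ereal_sup_ubound; exists a.
Qed.

Lemma cvg_hausdorff_dist (S : nat -> set X) A : (forall k, S k !=set0) ->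
  hausdorff_dist (S k) A @[k --> \oo] --> 0%E <->
  forall e, 0 < e ->
    \forall k \near \oo, excess_le e (S k) A /\ excess_le e A (S k).
Proof.
move=> S0; split=> [SA e e0|SA].
  have nb : nbhs (0%E : \bar R) [set y | (y < e%:E)%E].
    by apply: open_nbhs_nbhs; split; [exact: open_ereal_lt_ereal|rewrite /= lte_fin].
  have {}SA : \forall k \near \oo, (hausdorff_dist (S k) A < e%:E)%E := SA _ nb.
  by apply: filterS SA => k; exact: hausdorff_dist_lt.
have le e : 0 < e -> \forall k \near \oo, (0 <= hausdorff_dist (S k) A <= e%:E)%E.
  move=> /SA; apply: filterS => k [SkA ASk].
  by rewrite hausdorff_dist_ge0//= hausdorff_dist_le.
(* Convergence in the extended reals splits into eventual finiteness, obtained from the bound 1, and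
   convergence of the real values. *)
apply/fine_cvgP; split.
  apply: filterS (le 1 ltr01) => k /andP[h0 h1].
  by rewrite ge0_fin_numE// (le_lt_trans h1)// ltry.
apply/cvgrPdist_le => e e0; apply: filterS (le e e0) => k /= /andP[h0 he].
rewrite sub0r normrN ger0_norm ?fine_ge0// -lee_fin fineK//.
by rewrite ge0_fin_numE// (le_lt_trans he)// ltry.
Qed.

End Hausdorff.

(** * Segments and tags of a partition of [0, 1] *)

Section TaggedPartitions.
Context {R : realType}.
Implicit Type P : tagged_partition R.

Lemma cut_itv P m : (m <= size (cuts P))%N -> (0 :: cuts P)`_m \in `[0, 1].
Proof.
(* The index is in range, so the default may be changed to the right endpoint 1, as in the
   [itv_partition] lemmas. *)
move=> mP; have iP := @cutsP _ P; rewrite (set_nth_default 1)// in_itv/=.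
by rewrite itv_partition_nth_ge// itv_partition_nth_le.
Qed.

Lemma seg_tag_itv P i : @seg_tag R P i \in `[0, 1].
Proof.
have := seg_tagP i; rewrite !in_itv/= => /andP[ti it].
have := @cut_itv P i (ltnW (ltn_ord i)); have := @cut_itv P i.+1 (ltn_ord i).
rewrite !in_itv/= => /andP[_ i1] /andP[i0 _].
by rewrite (le_trans i0 ti) (le_trans it i1).
Qed.

Lemma seg_length_ge0 P i : 0 <= @seg_length R P i.
Proof.
have [/(pathP 0)lt _] := @cutsP _ P.
by rewrite subr_ge0 ltW// lt.
Qed.

Lemma sum_seg_length P : \sum_i @seg_length R P i = 1.
Proof.
have tele (s : seq R) x : \sum_(i < size s) (s`_i - (x :: s)`_i) = last x s - x.
  elim: s x => [|y s IH] x; first by rewrite big_ord0 subrr.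
  by rewrite big_ord_recl /= IH; ring.
by rewrite tele; have [_ /eqP->] := @cutsP _ P; rewrite subr0.
Qed.

(** One factor of each square is at most the mesh, and the lengths sum to 1. *)
Lemma sum_seg_length_sqr P : \sum_i @seg_length R P i ^+ 2 <= mesh P.
Proof.
rewrite -[leRHS]mulr1 -(sum_seg_length P) mulr_sumr; apply: ler_sum => i _.
by rewrite expr2 ler_wpM2r ?seg_length_ge0// /mesh le_bigmax.
Qed.

End TaggedPartitions.

(** * Comparison of the Riemann sums of [F] and [conv_multifun F] *)

Section RiemannSums.
Context {R : realType} {X : normedModType R} (F : R -> set X).

Lemma riemann_sum_conv_excess (M : R) (K : set X) (e : R) :
  (forall t a, t \in `[0, 1] -> F t a -> `|a| <= M) ->
  totally_bounded K -> 0 < e ->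
  exists2 d, 0 < d & forall P : tagged_partition R, mesh P < d ->
    excess_le e (riemann_sum (conv_multifun F) P) K ->
    excess_le (7 * e) (riemann_sum (conv_multifun F) P) (riemann_sum F P).
Proof.
move=> FM tK e0.
(* [s] is a finite [e]-net of [K - K], fixed before the partition. *)
have [s Ks] := totally_bounded_add tK (@totally_bounded_scale _ _ (-1) _ tK) e0.
have /choice[f fP] := @norming_functional R X.
pose n := size s; pose N := n%:R * (2 * M) ^+ 2 : R.
have N0 : 0 <= N by rewrite mulr_ge0// sqr_ge0.
have N1 : 0 < N + 1 by rewrite ltr_wpDl.
(* A mesh below this makes the selection bound [N * mesh P] at most [e ^+ 2]; the [+ 1] covers
   [N = 0]. *)
exists (e ^+ 2 / (N + 1)); first by rewrite divr_gt0// exprn_gt0.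
move=> P Pd PK x Px.
have [i a|j a|y Py xy] := @minkowski_sum_selection R X _
  (index_enum 'I_(size (cuts P))) (@seg_length R P)
  (fun i => F (seg_tag i)) n (fun j => f s`_j) M x _ _ Px.
- by apply: FM; exact: seg_tag_itv.
- exact: (fP _).1.
exists y => //.
have {}xy : \sum_(j < n) f s`_j (x - y) ^+ 2 <= e ^+ 2.
  apply: le_trans xy _; apply: le_trans (ler_wpM2l N0 (sum_seg_length_sqr P)) _.
  apply: le_trans (ler_wpM2l N0 (ltW Pd)) _.
  by rewrite mulrCA ger_pMr ?exprn_gt0// ler_pdivrMr// mul1r lerDl.
(* Both [x] and [y] are thus within [e] of [K], so [x - y] is within [3 * e] of a net point [z]. *)
have Py' : riemann_sum (conv_multifun F) P y.
  by apply: minkowski_sum_sub Py => i; exact: sub_conv_hull.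
have [b Kb xb] := PK _ Px; have [c Kc yc] := PK _ Py'.
have [|z /= zs bcz] := Ks (b - c).
  by exists b => //; exists (- c); [exists c; rewrite ?scaleN1r|].
have fz : `|f z (x - y)| <= e.
  have zn : (index z s < n)%N by rewrite index_mem.
  rewrite -ler_sqr ?nnegrE ?(ltW e0)// real_normK ?num_real//.
  apply: le_trans xy; rewrite (bigD1 (Ordinal zn))//= nth_index// lerDl.
  by apply: sumr_ge0 => j _; exact: sqr_ge0.
have xyz : `|x - y - z| <= 3 * e.
  rewrite (le_trans (ler_distD (b - c) _ _))//.
  rewrite [- (b - c)]opprD addrACA -opprD.
  have := ler_normB (x - b) (y - c); lra.
(* Hence [|z| <= e + 3 * e], and [|x - y| <= 3 * e + 4 * e], whence the factor 7. *)
have fxyz : f z (x - y - z) = f z (x - y) - `|z| by rewrite linearB (fP z).2.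
have := le_trans ((fP z).1 _) xyz; rewrite fxyz ler_norml => /andP[+ _].
move: fz; rewrite ler_norml => /andP[_ fz] fz'.
have := ler_normD (x - y - z) z; rewrite subrK; lra.
Qed.

Lemma near_riemann_sum_conv_excess (P : nat -> tagged_partition R) (A : set X) :
  bounded_multifun F -> mesh (P k) @[k --> \oo] --> (0 : R) ->
  totally_bounded A ->
  (forall e, 0 < e ->
    \forall k \near \oo, excess_le e (riemann_sum (conv_multifun F) (P k)) A) ->
  forall e, 0 < e -> \forall k \near \oo,
    excess_le e (riemann_sum (conv_multifun F) (P k)) (riemann_sum F (P k)).
Proof.
move=> Fb P0 tA PA e e0.
have [M FM] : exists M : R, forall t a, t \in `[0, 1] -> F t a -> `|a| <= M.
  have FS t a : t \in `[0, 1] -> F t a -> (`|a|%:E <= multifun_sup_norm F)%E.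
    by move=> t01 Fa; apply: ereal_sup_ubound; exists a => //; exists t.
  move: Fb FS; rewrite /bounded_multifun; case: multifun_sup_norm => [M||] // _ FS.
    by exists M => t a t01 Fa; rewrite -lee_fin (FS t).
  (* A supremum [-oo] means that there are no values to bound. *)
  by exists 0 => t a t01 /(FS _ _ t01); rewrite leeNy_eq.
have e7 : 0 < e / 7 by rewrite divr_gt0.
have [d d0 Pd] := riemann_sum_conv_excess FM tA e7.
have -> : e = 7 * (e / 7) by field.
near=> k; apply: Pd; last by near: k; exact: PA.
apply: le_lt_trans (ler_norm _) _.
by near: k; apply: cvgr0_norm_lt.
Unshelve. all: by end_near. Qed.

Hypothesis F_nonempty : forall t : R, t \in `[0, 1] -> F t !=set0.
Hypothesis F_compact : forall t : R, t \in `[0, 1] -> compact (F t).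
Hypothesis F_bounded : bounded_multifun F.

Let riemann_sum_sub P : riemann_sum F P `<=` riemann_sum (conv_multifun F) P.
Proof. by apply: minkowski_sum_sub => i; exact: sub_conv_hull. Qed.

Let riemann_sum_nonempty P : riemann_sum F P !=set0.
Proof. by apply: minkowski_sum_nonempty => i; apply: F_nonempty; exact: seg_tag_itv. Qed.

Let totally_bounded_F P i : totally_bounded (F (@seg_tag R P i)).
Proof. by apply/compact_totally_bounded/F_compact; exact: seg_tag_itv. Qed.

Lemma cvg_riemann_sum_conv (P : nat -> tagged_partition R) (A : set X) :
  mesh (P k) @[k --> \oo] --> (0 : R) ->
  hausdorff_dist (riemann_sum (conv_multifun F) (P k)) A @[k --> \oo] --> 0%E <->
  hausdorff_dist (riemann_sum F (P k)) A @[k --> \oo] --> 0%E.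
Proof.
move=> P0; pose S k := riemann_sum F (P k).
pose Sc k := riemann_sum (conv_multifun F) (P k).
have S_tb k : totally_bounded (S k) by exact: totally_bounded_minkowski_sum.
have Sc_tb k : totally_bounded (Sc k).
  by apply: totally_bounded_minkowski_sum => i; exact: totally_bounded_conv_hull.
rewrite -/S -/Sc !cvg_hausdorff_dist; last 2 first.
- by move=> k; exact: riemann_sum_nonempty.
- by move=> k; have [x /riemann_sum_sub] := riemann_sum_nonempty (P k); exists x.
split=> SA e e0; have e20 : 0 < e / 2 by rewrite divr_gt0.
(* [A] is approximated by totally bounded sums, so it can serve as the set [K]. *)
- have tA : totally_bounded A.
    apply: totally_bounded_excess => d /SA[k _ /(_ k (leqnn k))[_ AS]].
    by exists (Sc k).
  have ScS : \forall k \near \oo, excess_le (e / 2) (Sc k) (S k).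
    apply: near_riemann_sum_conv_excess P0 tA _ _ e20 => // d /SA.
    by apply: filterS => k [].
  near=> k; split=> [x /riemann_sum_sub|].
    by move: x; near: k; move: (SA e e0); apply: filterS => k [].
  rewrite [e]splitr; apply: (@excess_le_trans _ _ _ (Sc k)); last by near: k.
  by near: k; move: (SA _ e20); apply: filterS => k [].
- have tA : totally_bounded A.
    apply: totally_bounded_excess => d /SA[k _ /(_ k (leqnn k))[_ AS]].
    by exists (S k).
  have ScS : \forall k \near \oo, excess_le (e / 2) (Sc k) (S k).
    (* Here only the sums of [F] are known to approach [A]; those of [conv_multifun F], lying in the
       hulls of these sums, approach the hull of [A], which serves as [K]. *)
    have tcA := totally_bounded_conv_hull tA.
    apply: near_riemann_sum_conv_excess P0 tcA _ _ e20 => // d d0.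
    move: (SA _ d0); apply: filterS => k [SkA _] x /minkowski_sum_conv_hull; move: x.
    apply: excess_le_conv_hull; first exact: convex_conv_hull.
    by move=> x /SkA[a Aa xa]; exists a => //; exact: sub_conv_hull.
  near=> k; split; last first.
    move=> a Aa; have [y Sy ay] : exists2 y, S k y & `|a - y| <= e.
      by move: a Aa; near: k; move: (SA e e0); apply: filterS => k [].
    by exists y => //; exact: riemann_sum_sub.
  rewrite [e]splitr; apply: (@excess_le_trans _ _ _ (S k)); first by near: k.
  by near: k; move: (SA _ e20); apply: filterS => k [].
Unshelve. all: by end_near. Qed.

End RiemannSums.

Unset Implicit Arguments.

(* A multifunction on [0, 1] is a map on R whose values outside [0, 1] are
   irrelevant. *)
Theorem theorem2p8 (R : realType) (X : completeNormedModType R)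
    (F : R -> set X)
    (F_nonempty : forall t : R, t \in `[0, 1] -> F t !=set0)
    (F_compact : forall t : R, t \in `[0, 1] -> compact (F t))
    (F_bounded : bounded_multifun F) :
  riemann_limit_sets (conv_multifun F) = riemann_limit_sets F.
Proof.
apply/seteqP; split=> A [A0 cA [P [P0 PA]]]; split=> //; exists P; split=> //.
  exact/(cvg_riemann_sum_conv F_nonempty F_compact F_bounded A P0).
exact/(cvg_riemann_sum_conv F_nonempty F_compact F_bounded A P0).
Qed.
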